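(* For every positive integer $n$, $\mu(3n-1)\equiv0\pmod 3$.
   Context: The integers $\mu(n)$, $n\ge0$, are defined by $$\sum_{n=0}^\infty\mu(n)q^n=\prod_{n=1}^\infty(1-q^n)^8(1-q^{2n})^8.$$ Equivalently, $\mu(n)=\mu_e(n)-\mu_o(n)$, where $\mu_e(n)$ and $\mu_o(n)$ are the number of $16$-colored partitions of $n$ into an even (respectively, odd) number of distinct parts, where all the parts of the latter eight colors are even (copies of the same integer in different colors are regarded as distinct). *)

(* Defs.v *)
From mathcomp Require Import all_boot all_order all_algebra.

Set Implicit Arguments.
Unset Strict Implicit.
Unset Printing Implicit Defensive.

Import GRing.Theory.
Local Open Scope ring_scope.

Definition mu_partial_prod (N : nat) : {poly int} :=
  \prod_(1 <= k < N.+1) ((1 - 'X^k) ^+ 8 * (1 - 'X^(2 * k)) ^+ 8).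

(* The coefficient of q^n in the infinite product: factors of index k > n
   are 1 modulo q^(n+1), so the n-th partial product already has the right
   coefficient; mu_partial_prod_coef states this stabilization. *)
Definition mu (n : nat) : int := (mu_partial_prod n)`_n.

Lemma mu_partial_prod_coef (n N : nat) :
  (n <= N)%N -> (mu_partial_prod N)`_n = mu n.
Proof.
have mulXn (p : {poly int}) m : (n < m)%N -> (p * (1 - 'X^m))`_n = p`_n.
  by move=> lt_nm; rewrite mulrBr mulr1 coefB coefMXn lt_nm subr0.
have mulXn8 (p : {poly int}) m e :
    (n < m)%N -> (p * (1 - 'X^m) ^+ e)`_n = p`_n.
  move=> lt_nm; elim: e => [|e IHe]; first by rewrite expr0 mulr1.
  by rewrite exprSr mulrA mulXn.
elim: N => [|N IHN]; first by rewrite leqn0 => /eqP ->.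
rewrite leq_eqVlt => /predU1P[-> // | lt_nN].
rewrite /mu_partial_prod big_nat_recr //= mulrA !mulXn8 ?IHN //.
by rewrite (leq_trans lt_nN) // leq_pmull.
Qed.

(* Main.v *)
Require Import Defs.
From mathcomp Require Import all_boot all_order all_algebra.
From mathcomp Require Import zify ring.

(** Write P = (1-q)(1-q^2)(1-q^3)... and Q = (1-q^2)(1-q^4)(1-q^6)..., so that
    the generating function of mu is P^8 Q^8. It factors as
      P^8 Q^8 = (P^2 Q^3)^3 * (P^2 / Q).
    Modulo 3 a cube has only exponents divisible by 3 (Frobenius;
    coef_expr_pchar), and Gauss's identity
      P^2 / Q = sum over all integers k of (-1)^k q^(k^2)
    shows that the second factor has only squares as exponents. Since a square
    is 0 or 1 modulo 3, no exponent of the product is 2 modulo 3.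

    Everything is carried out with polynomials, up to a power of the variable.
    With O the product of the 1 - q^(2i+1) and E that of the 1 - q^(2i+2), for
    i < n, one has P = O E and Q = E modulo q^(2n+1), hence P^2 / Q = O^2 E
    there. A finite form of Gauss's identity comes from the q-binomial theorem
    (q_binomial) in base q^2 with 2n factors, evaluated at the midpoint
    q^(2n-1): the factors pair up into O^2, and the sum becomes that of
    (-1)^k q^(k^2) [2n, n+k] over |k| <= n (odd_qprod_sqr). Multiplying by E
    replaces each Gaussian binomial by 1 modulo q^(2n+1), because its error
    term is shifted by q^(k^2) (gauss_theta). *)

Set Implicit Arguments.
Unset Strict Implicit.
Unset Printing Implicit Defensive.

Import GRing.Theory.

Local Open Scope ring_scope.

(** * Gaussian binomials and the q-binomial theorem *)

Section GaussianBinomials.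

Variables (R : comNzRingType) (x : R).

Fixpoint gauss_bin (n m : nat) : R :=
  match n, m with
  | _, 0 => 1
  | 0, _.+1 => 0
  | n'.+1, m'.+1 => gauss_bin n' m' + x ^+ m * gauss_bin n' m
  end.

Definition qfact (n : nat) : R := \prod_(i < n) (1 - x ^+ i.+1).

Lemma gauss_bin0 n : gauss_bin n 0 = 1.
Proof. by case: n. Qed.

Lemma gauss_binS n m :
  gauss_bin n.+1 m.+1 = gauss_bin n m + x ^+ m.+1 * gauss_bin n m.+1.
Proof. by []. Qed.

Lemma gauss_bin_small n m : (n < m)%N -> gauss_bin n m = 0.
Proof.
elim: n m => [|n IHn] [|m] //= lt_nm.
by rewrite !IHn ?mulr0 ?addr0 // ltnW.
Qed.

Lemma qfactS n : qfact n.+1 = qfact n * (1 - x ^+ n.+1).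
Proof. by rewrite /qfact big_ord_recr. Qed.

Lemma qfactD n m :
  qfact (n + m) = qfact n * \prod_(i < m) (1 - x ^+ (n + i).+1).
Proof. by rewrite /qfact big_split_ord. Qed.

(** The quotient formula for Gaussian binomials, in a form free of division. *)
Lemma gauss_bin_fact a b :
  gauss_bin (a + b) a * qfact a * qfact b = qfact (a + b).
Proof.
have [n] := ubnP (a + b); elim: n a b => // n IHn [|a] [|b] lt_n.
- by rewrite /qfact !big_ord0 !mulr1.
- by rewrite gauss_bin0 /qfact big_ord0 !mul1r.
- have := IHn a 0 ltac:(lia); rewrite !addn0 => IHa.
  rewrite gauss_binS (gauss_bin_small (ltnSn a)) mulr0 addr0 !qfactS.
  by rewrite -[in RHS]IHa; ring.
- have IHa := IHn a b.+1 ltac:(lia); have IHb := IHn a.+1 b ltac:(lia).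
  rewrite addSn gauss_binS (qfactS (a + b.+1)).
  transitivity (gauss_bin (a + b.+1) a * qfact a * qfact b.+1 * (1 - x ^+ a.+1)
    + x ^+ a.+1 * (1 - x ^+ b.+1)
      * (gauss_bin (a.+1 + b) a.+1 * qfact a.+1 * qfact b)).
    by rewrite addSnnS !qfactS; ring.
  by rewrite IHa IHb addSnnS -addSn exprD; ring.
Qed.

(** The homogeneous form in v and w makes it possible to take for v / w a
    negative power of x, as Gauss's identity requires, inside a polynomial
    ring. The induction splits off the factor i = 0 and rescales w by x. *)
Lemma q_binomial n (v w : R) :
  \prod_(i < n) (v - w * x ^+ i) =
  \sum_(j < n.+1) (-1) ^+ j * x ^+ 'C(j, 2) * w ^+ j * v ^+ (n - j)
                  * gauss_bin n j.
Proof.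
elim: n w => [|n IHn] w.
  by rewrite big_ord0 big_ord1 /= !expr0 !mulr1.
have -> : \prod_(i < n.+1) (v - w * x ^+ i) =
    (v - w) * \prod_(i < n) (v - w * x * x ^+ i).
  rewrite big_ord_recl expr0 mulr1; congr (_ * _).
  by apply: eq_bigr => i _; rewrite lift0 exprS mulrA.
rewrite IHn [RHS]big_ord_recl !expr0 subn0 gauss_bin0 !mulr1 mul1r.
under [in RHS]eq_bigr => i _.
  rewrite lift0 subSS gauss_binS addrC mulrDr.
  over.
rewrite big_split /= addrA mulrBl !big_distrr /= -sumrN.
congr (_ + _).
  rewrite big_ord_recl /= [in RHS]big_ord_recr /=.
  rewrite (gauss_bin_small (ltnSn n)) !mulr0 addr0 gauss_bin0 !expr0 subn0 !mul1r !mulr1 -exprS; congr (_ + _).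
  apply: eq_bigr => i _; rewrite /bump add1n.
  rewrite -(subnSK (ltn_ord i)) binS bin1 exprD exprMn !exprS; ring.
apply: eq_bigr => i _.
rewrite binS bin1 exprD exprMn !exprS; ring.
Qed.

End GaussianBinomials.

(** * Congruences modulo an element *)

Section Congruence.

Variable R : comNzRingType.
Implicit Types y p q r : R.

Definition eqmod y p q := exists r, p = q + y * r.

Lemma eqmod_refl y p : eqmod y p p.
Proof. by exists 0; rewrite mulr0 addr0. Qed.

Lemma eqmodD y p1 q1 p2 q2 :
  eqmod y p1 q1 -> eqmod y p2 q2 -> eqmod y (p1 + p2) (q1 + q2).
Proof. by move=> [r1 ->] [r2 ->]; exists (r1 + r2); ring. Qed.

Lemma eqmodM y p1 q1 p2 q2 :
  eqmod y p1 q1 -> eqmod y p2 q2 -> eqmod y (p1 * p2) (q1 * q2).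
Proof.
move=> [r1 ->] [r2 ->]; exists (q1 * r2 + r1 * q2 + y * r1 * r2); ring.
Qed.

Lemma eqmod_sum y n (F G : 'I_n -> R) :
  (forall i, eqmod y (F i) (G i)) -> eqmod y (\sum_i F i) (\sum_i G i).
Proof.
by move=> FG; apply: big_ind2 => //; [exact: eqmod_refl | exact: eqmodD].
Qed.

Lemma qprod_eqmod1 x m n k : (m <= n)%N ->
  eqmod (x ^+ m) (\prod_(i < k) (1 - x ^+ (n + i))) 1.
Proof.
move=> le_mn; elim/big_ind: _ => [|p q p1 q1|i _]; first exact: eqmod_refl.
  by rewrite -[1]mulr1; apply: eqmodM.
exists (- x ^+ (n + i - m)).
by rewrite mulrN -exprD subnKC // (leq_trans le_mn) ?leq_addr.
Qed.

End Congruence.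

Lemma coef_eqmodXn (R : comNzRingType) m (p q : {poly R}) i :
  eqmod 'X^m p q -> (i < m)%N -> p`_i = q`_i.
Proof. by move=> [r ->] lt_im; rewrite coefD coefXnM lt_im addr0. Qed.

(** Euler's splitting of a product into its odd and its even factors. *)
Lemma qfact_double (R : comNzRingType) (x : R) n :
  qfact x n.*2 = \prod_(i < n) (1 - x ^+ i.*2.+1) * qfact (x ^+ 2) n.
Proof.
elim: n => [|n IHn]; first by rewrite /qfact !big_ord0 mulr1.
rewrite doubleS !qfactS IHn big_ord_recr /= -exprM mul2n doubleS; ring.
Qed.

(** * Gauss's theta identity, modulo a power of the variable *)

(** The exponent bookkeeping behind Gauss's identity: in the q-binomial sum
    over base q^2, completing the square in j turns the exponent of the j-th
    term into (j - n)^2 plus a constant that does not depend on j. *)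
Lemma q_binomial_exponent n j : (j <= n.*2)%N ->
  (2 * 'C(j, 2) + n.*2.-1 * (n.*2 - j) =
   n * n.-1 + n.*2.-1 * n + `|j - n|%N ^ 2)%N.
Proof.
have bin2E : (2 * 'C(j, 2) + j = j * j)%N.
  have := bin_ffact j 2; rewrite ffactnS ffactn1 (_ : 2`! = 2)%N //.
  by case: (j) => [|i] /=; nia.
case: n => [|k] le_j; first by move: bin2E; nia.
have [le_jn|/ltnW le_nj] := leqP j k.+1.
  rewrite distnEr //; have [d defd] : exists d, (k.+1 = j + d)%N.
    by exists (k.+1 - j)%N; lia.
  have -> : (k.+1 - j = d)%N by lia.
  have -> : (k.+1.*2 - j = j + 2 * d)%N by lia.
  have -> : (k.+1.*2.-1 = k + j + d)%N by lia.
  have defk : (k + 1 = j + d)%N by lia.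
  move: 'C(j, 2) bin2E defk => C; case: j {le_j le_jn defd} => [|i] CE defk.
    have -> : C = 0%N by lia.
    have -> : d = k.+1 by lia.
    nia.
  have -> : k = (i + d)%N by lia.
  nia.
rewrite distnEl //; have [d defd] : exists d, (j = k.+1 + d)%N.
  by exists (j - k.+1)%N; lia.
have -> : (j - k.+1 = d)%N by lia.
have [e defe] : exists e, (k.+1 = d + e)%N by exists (k.+1 - d)%N; lia.
have -> : (k.+1.*2 - j = e)%N by lia.
have -> : (k.+1.*2.-1 = 2 * k + 1)%N by lia.
nia.
Qed.

Section Theta.

Variable R : idomainType.

Local Notation x := ('X^2 : {poly R}).

Definition theta n : {poly R} :=
  \sum_(j < n.*2.+1) (-1) ^+ (n + j) * 'X^(`|j - n|%N ^ 2).

Lemma qfactX_neq0 k n : (0 < k)%N -> qfact ('X^k : {poly R}) n != 0.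
Proof.
move=> k_gt0; apply/prodf_neq0 => i _; rewrite -exprM -opprB oppr_eq0.
by rewrite monic_neq0 // monicXnsubC // muln_gt0 k_gt0.
Qed.

(** The quotient formula, read after cancelling the factorial of the larger of
    a and b, leaves a product of factors 1 - x^k with k > min(a, b); extending
    the other factorial up to n only adds more such factors. *)
Lemma gauss_bin_eqmod1 a b n : (minn a b <= n)%N ->
  eqmod (x ^+ (minn a b).+1) (gauss_bin x (a + b) a * qfact x n) 1.
Proof.
move=> le_n.
have [k ->] : exists k, n = (minn a b + k)%N.
  by exists (n - minn a b)%N; rewrite subnKC.
have qprod1 m c : (minn a b <= m)%N -> eqmod (x ^+ (minn a b).+1)
    (\prod_(i < c) (1 - x ^+ (m + i).+1)) 1.
  by move=> le_m; have := @qprod_eqmod1 _ x (minn a b).+1 m.+1 c le_m.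
rewrite qfactD mulrA -[X in eqmod _ _ X]mulr1; apply: eqmodM; last exact: qprod1.
have eq_ab := gauss_bin_fact x a b.
have [min_a | min_b] : minn a b = a \/ minn a b = b by lia.
  suff -> : gauss_bin x (a + b) a * qfact x (minn a b) =
      \prod_(i < a) (1 - x ^+ (b + i).+1) by apply: qprod1; apply: geq_minr.
  apply: (mulfI (qfactX_neq0 b (isT : 0 < 2)%N)).
  by rewrite min_a -qfactD addnC mulrC addnC.
suff -> : gauss_bin x (a + b) a * qfact x (minn a b) =
    \prod_(i < b) (1 - x ^+ (a + i).+1) by apply: qprod1; apply: geq_minl.
apply: (mulfI (qfactX_neq0 a (isT : 0 < 2)%N)).
by rewrite min_b -qfactD -eq_ab mulrA [qfact _ a * _]mulrC.
Qed.

(** The finite Gauss identity: the q-binomial theorem in base q^2 with 2n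
    factors q^(2n-1) - q^(2i). The point q^(2n-1) lies halfway between the
    exponents 2n-2 and 2n, so that the factors with i < n and those with
    i >= n both give, up to sign and a monomial, the product of the odd factors. *)
Lemma odd_qprod_sqr n :
  (\prod_(i < n) (1 - 'X^(i.*2.+1)) : {poly R}) ^+ 2 =
  \sum_(j < n.*2.+1) (-1) ^+ (n + j) * 'X^(`|j - n|%N ^ 2)
                      * gauss_bin x n.*2 j.
Proof.
set P := \prod_(i < n) _.
have lowE : \prod_(i < n) ('X^(n.*2.-1) - x ^+ i) =
    (-1) ^+ n * 'X^(n * n.-1) * P.
  have -> : (-1) ^+ n * 'X^(n * n.-1) = \prod_(i < n) (- x ^+ i).
    elim: n {P} => [|k IHk]; first by rewrite big_ord0 !expr0 mulr1.
    rewrite big_ord_recr /= -IHk -exprM exprS.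
    have -> : (k.+1 * k = k * k.-1 + 2 * k)%N by nia.
    by rewrite exprD; ring.
  rewrite /P [X in _ * X](reindex_inj rev_ord_inj) -big_split /=.
  apply: eq_bigr => i _; have lt_i := ltn_ord i.
  rewrite mulrBr mulr1 mulNr opprK -!exprM -exprD addrC; congr (_ + 'X^_).
  by rewrite -muln2; lia.
have highE : \prod_(i < n) ('X^(n.*2.-1) - x ^+ (n + i)) =
    'X^(n.*2.-1 * n) * P.
  have -> : 'X^(n.*2.-1 * n) = \prod_(i < n) 'X^(n.*2.-1) :> {poly R}.
    by rewrite prodr_const card_ord exprM.
  rewrite -big_split /=.
  apply: eq_bigr => i _; have lt_i := ltn_ord i.
  rewrite mulrBr mulr1 -!exprM -exprD; congr (_ - 'X^_).
  by lia.
pose K := (n * n.-1 + n.*2.-1 * n)%N.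
have K_neq0 : 'X^K != 0 :> {poly R} by rewrite monic_neq0 ?monicXn.
(* 'X^K is what the two halves of the product lose, up to sign, when their
   factors are normalised to constant term 1. *)
apply: (mulfI K_neq0).
transitivity ((-1) ^+ n * \prod_(i < n.*2) ('X^(n.*2.-1) - 1 * x ^+ i)).
  under eq_bigr do rewrite mul1r.
  rewrite -addnn big_split_ord /= addnn lowE highE /K exprD.
  have sgn : (-1) ^+ n * (-1) ^+ n = 1 :> {poly R} by rewrite -expr2 sqrr_sign.
  by rewrite !mulrA sgn; ring.
rewrite q_binomial !big_distrr /=; apply: eq_bigr => j _.
rewrite expr1n mulr1 -!exprM !mulrA; congr (_ * _).
rewrite -exprD -mulrA -exprD [RHS]mulrAC -exprD [RHS]mulrC; congr (_ * 'X^_).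
apply: q_binomial_exponent; exact: leq_ord.
Qed.

(** Gauss's identity. In the term of index j, with d = |j - n|, the Gaussian
    binomial times the factorial is 1 modulo q^(2(n-d)+2), and it is shifted
    by d^2; the error has degree at least d^2 + 2(n-d) + 2 = (d-1)^2 + 2n + 1,
    so that the bound 2n+1 holds uniformly in j. *)
Lemma gauss_theta n :
  eqmod 'X^(n.*2.+1)
    ((\prod_(i < n) (1 - 'X^(i.*2.+1))) ^+ 2 * qfact x n) (theta n).
Proof.
rewrite odd_qprod_sqr big_distrl /=; apply: eqmod_sum => j.
rewrite -!mulrA -[X in eqmod _ _ (_ * X)]mulr1.
apply: eqmodM; first exact: eqmod_refl.
have lt_j := ltn_ord j; set d := `|j - n|%N.
have min_d : minn j (n.*2 - j) = (n - d)%N by rewrite /d; lia.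
have := @gauss_bin_eqmod1 j (n.*2 - j) n; rewrite min_d subnKC //.
case=> [|r ->]; first exact: leq_subr.
have le_dn : (d <= n)%N by rewrite /d; lia.
have [e def_e] : exists e, (d ^ 2 + 2 * (n - d).+1 = n.*2.+1 + e)%N.
  by exists (d ^ 2 + 2 * (n - d).+1 - n.*2.+1)%N; rewrite subnKC //; nia.
by exists ('X^e * r); rewrite mulrDr -exprM !mulrA -!exprD def_e.
Qed.

Lemma theta_coef_eq0 n k : (k %% 3 = 2)%N -> (theta n)`_k = 0.
Proof.
move=> k2; rewrite coef_sum big1 // => j _.
rewrite -signr_odd; set d := `|_|%N; suff d2 : (k == d ^ 2)%N = false.
  by case: odd; rewrite ?expr0 ?expr1 ?mulN1r ?mul1r ?coefN coefXn d2 ?oppr0.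
apply/negP => /eqP kd; move: k2; rewrite kd -modnXm.
by have := ltn_pmod d (isT : 0 < 3)%N; case: (d %% 3)%N => [|[|[|]]].
Qed.

End Theta.

(** * The congruence for mu *)

(** In characteristic p, raising to the power p is additive, so it acts on a
    polynomial monomial by monomial. *)
Lemma coef_expr_pchar (R : comNzRingType) p (r : {poly R}) i :
  p \in [pchar R] -> ~~ (p %| i)%N -> (r ^+ p)`_i = 0.
Proof.
rewrite -(pchar_poly R) => charRp ndiv.
rewrite -[r]coefK poly_def -(pFrobenius_autE charRp) rmorph_sum coef_sum /=.
rewrite big1 // => j _.
rewrite pFrobenius_autE exprZn coefZ -exprM coefXn.
by case: eqP ndiv => [->|]; rewrite ?dvdn_mull // mulr0.
Qed.

Theorem theorem6p1 (n : nat) :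
  (0 < n)%N -> (mu (3 * n - 1)%N = 0 %[mod 3])%Z.
Proof.
move=> n_gt0; set m := (3 * n - 1)%N.
have m2 : (m %% 3 = 2)%N by rewrite /m; lia.
have char3 : 3 \in [pchar 'F_3] by apply: pchar_Fp.
apply/eqP; rewrite eqz_mod_dvd subr0 (dvdz_pcharf char3).
(* An even number of factors is taken so that they split into odd and even
   ones; Gauss's identity then holds up to degree 2m, beyond m. *)
rewrite -(@mu_partial_prod_coef m m.*2); last by lia.
rewrite -coef_map /=.
pose P : {poly 'F_3} := qfact 'X m.*2; pose Q : {poly 'F_3} := qfact 'X^2 m.*2.
have -> : map_poly intr (mu_partial_prod m.*2) = P ^+ 8 * Q ^+ 8.
  rewrite rmorph_prod /= big_add1 big_mkord -!prodrXl -big_split /=.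
  apply: eq_bigr => i _.
  by rewrite rmorphM !rmorphXn !rmorphB rmorph1 /= !map_polyXn exprM.
pose O : {poly 'F_3} := \prod_(i < m) (1 - 'X^(i.*2.+1)).
pose E : {poly 'F_3} := qfact 'X^2 m.
pose T : {poly 'F_3} := \prod_(i < m) (1 - 'X^2 ^+ (m.+1 + i)).
have defP : P = O * E by apply: qfact_double.
have defQ : Q = E * T by rewrite /Q -addnn qfactD.
(* P^2 / Q is O^2 E / T; taking P^2 Q^2 E rather than P^2 Q^3 as the cube
   root turns 1 / T into T^2 and avoids the division. *)
have -> : P ^+ 8 * Q ^+ 8 = (P ^+ 2 * Q ^+ 2 * E) ^+ 3 * (O ^+ 2 * E * T ^+ 2).
  by rewrite defP defQ; ring.
set C := (_ ^+ 3).
have T1 : eqmod 'X^(m.*2.+1) T 1.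
  have [r ->] : eqmod ('X^2 ^+ m.+1) T 1 by apply: qprod_eqmod1.
  by exists ('X * r); rewrite -exprM mul2n doubleS exprSr; ring.
have CT : eqmod 'X^(m.*2.+1) (C * (O ^+ 2 * E * T ^+ 2)) (C * theta _ m).
  rewrite -[theta _ m]mulr1 -[X in theta _ m * X](mulr1 1).
  apply: eqmodM (eqmod_refl _ _) (eqmodM (gauss_theta _ m) _).
  by rewrite expr2; apply: eqmodM.
rewrite (coef_eqmodXn CT); last by lia.
rewrite coefM big1 // => i _.
have [div3 | ndiv3] := boolP (3 %| i)%N; last first.
  by rewrite coef_expr_pchar ?mul0r.
by rewrite theta_coef_eq0 ?mulr0 //; have := ltn_ord i; lia.
Qed.
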